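(* Let $\mathcal{L}$ be a linear space of real symmetric $n\times n$ matrices that is invariant under the action of a permutation $\sigma\in S_n$. Then the ideal $I(\mathrm{GV}(\mathcal{L}))$ of the corresponding Gibbs variety is also invariant under the action of $\sigma$.
   Context: $\mathbb{S}^n$ denotes the real vector space of real symmetric $n\times n$ matrices. The Gibbs variety $\mathrm{GV}(\mathcal{L})$ of a linear subspace $\mathcal{L}\subset\mathbb{S}^n$ is the Zariski closure of $\{\exp(A): A\in\mathcal{L}\}$ (matrix exponential) in $\mathbb{C}^{\binom{n+1}{2}}$, the space of complex symmetric $n\times n$ matrices with coordinates $\mathbf{x}=(x_{ij})_{1\leqslant i\leqslant j\leqslant n}$, where $x_{ij}$ and $x_{ji}$ are identified. $I(\mathrm{GV}(\mathcal{L}))$ is the ideal of polynomials in $\mathbb{R}[\mathbf{x}]$ vanishing on $\mathrm{GV}(\mathcal{L})$. Actions of the symmetric group $S_n$: $\sigma\in S_n$ acts on $\mathbb{R}[\mathbf{x}]$ by the algebra automorphism sending $x_{ij}$ to $x_{\sigma(i)\sigma(j)}$, and it acts on $\mathbb{S}^n$ by simultaneously permuting rows and columns of a matrix according to $\sigma$. *)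

(* Defs.v *)
From HB Require Import structures.
From mathcomp Require Import all_boot all_order all_algebra all_fingroup.
From mathcomp Require Import all_classical all_reals all_analysis.
From mathcomp Require Import complex.
(* Only the canonical structures of mpoly are imported: its notations clash with those of mathcomp-analysis. *)
From mathcomp Require mpoly.
Import (canonicals) mpoly.

Set Implicit Arguments.
Unset Strict Implicit.
Unset Printing Implicit Defensive.

Import Order.TTheory GRing.Theory Num.Theory.
Import numFieldNormedType.Exports.

Local Open Scope classical_set_scope.
Local Open Scope ring_scope.

Definition expmx (R : realType) (n : nat) (A : 'M[R]_n) : 'M[R]_n :=
  limn (series (fun k => (k`!%:R)^-1 *: A ^+ k)).

Section Coordinates.
Variable n : nat.

Definition sym_index := {p : 'I_n * 'I_n | (p.1 <= p.2)%N}.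

Definition nb_sym : nat := #|{: sym_index}|.

Lemma nb_symE : nb_sym = 'C(n.+1, 2).
Proof.
rewrite /nb_sym card_sig -sum1_card.
rewrite -(pair_big_dep xpredT (fun i j : 'I_n => (i <= j)%N) (fun _ _ => 1%N)) /=.
rewrite -bin2_sum big_mkord big_ord_recl add0n (reindex_inj rev_ord_inj) /=.
apply: eq_bigr => i _; rewrite /bump /= add1n.
rewrite (reindex_inj rev_ord_inj) /=.
rewrite (eq_bigl (fun j : 'I_n => (j < i.+1)%N)); last first.
  by move=> j; have := ltn_ord i; have := ltn_ord j => /= ? ?; rewrite leq_sub2lE.
rewrite (big_ord_narrow (ltn_ord i)) sum1_card card_ord //.
Qed.

Definition sort_pair (i j : 'I_n) : 'I_n * 'I_n :=
  if (i <= j)%N then (i, j) else (j, i).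

Lemma sort_pairP (i j : 'I_n) :
  ((sort_pair i j).1 <= (sort_pair i j).2)%N.
Proof. by rewrite /sort_pair; case: ifP => //= /negbT; rewrite -ltnNge => /ltnW. Qed.

(* The index of the coordinate x_ij, which is also that of x_ji. *)
Definition sym_var (i j : 'I_n) : 'I_nb_sym :=
  enum_rank (exist _ (sort_pair i j) (sort_pairP i j) : sym_index).

Definition var_pair (k : 'I_nb_sym) : 'I_n * 'I_n :=
  val (enum_val k : sym_index).

Lemma var_pairK (k : 'I_nb_sym) :
  sym_var (var_pair k).1 (var_pair k).2 = k.
Proof.
rewrite -[RHS]enum_valK; congr enum_rank; apply: val_inj => /=.
by rewrite /sort_pair /var_pair (valP (enum_val k)) -surjective_pairing.
Qed.

Lemma sym_varC (i j : 'I_n) : sym_var i j = sym_var j i.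
Proof.
congr enum_rank; apply: val_inj; rewrite /= /sort_pair.
by case: ltngtP => // /val_inj ->.
Qed.

Definition sym_poly (K : nzRingType) := mpoly.mpoly nb_sym K.

Definition sym_eval (K : comNzRingType) (M : 'M[K]_n) (f : sym_poly K) : K :=
  mpoly.meval (fun k => M (var_pair k).1 (var_pair k).2) f.

Definition sym_X (K : nzRingType) (i j : 'I_n) : sym_poly K :=
  mpoly.mpolyX K (mpoly.mnm1 (sym_var i j)).

Definition perm_poly (K : comNzRingType) (s : 'S_n) (f : sym_poly K) :
    sym_poly K :=
  mpoly.mmap (@mpoly.mpolyC nb_sym K)
    (fun k => sym_X K (s (var_pair k).1) (s (var_pair k).2)) f.

Lemma sym_XC (K : nzRingType) (i j : 'I_n) : sym_X K i j = sym_X K j i.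
Proof. by rewrite /sym_X sym_varC. Qed.

Lemma var_pair_sym_var (i j : 'I_n) : var_pair (sym_var i j) = sort_pair i j.
Proof. by rewrite /var_pair /sym_var enum_rankK. Qed.

Lemma sym_eval_X (K : comNzRingType) (M : 'M[K]_n) (i j : 'I_n) :
  M^T = M -> sym_eval M (sym_X K i j) = M i j.
Proof.
move=> symM; rewrite /sym_eval mpoly.mevalXU var_pair_sym_var /sort_pair.
by case: ifP => // _; rewrite -[in LHS]symM mxE.
Qed.

Lemma perm_poly_X (K : comNzRingType) (s : 'S_n) (i j : 'I_n) :
  perm_poly s (sym_X K i j) = sym_X K (s i) (s j).
Proof.
rewrite /perm_poly mpoly.mmapX mpoly.mmap1U var_pair_sym_var /sort_pair.
by case: ifP => // _; rewrite sym_XC.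
Qed.

Lemma perm_polyM (K : comNzRingType) (s t : 'S_n) (f : sym_poly K) :
  perm_poly (s * t)%g f = perm_poly t (perm_poly s f).
Proof.
elim/mpoly.mpolyind: f => [|c m f _ _ IH]; first by rewrite /perm_poly !raddf0.
rewrite /perm_poly !raddfD /= -!/(perm_poly _ _) IH; congr (_ + _).
rewrite /perm_poly !mpoly.mmapZ rmorphM /= mpoly.mmapC; congr (_ * _).
rewrite !mpoly.mmapX /mpoly.mmap1 rmorph_prod; apply: eq_bigr => k _ /=.
by rewrite rmorphXn /= -/(perm_poly _ _) perm_poly_X !permM.
Qed.

Lemma perm_poly1 (K : comNzRingType) (f : sym_poly K) : perm_poly 1%g f = f.
Proof.
elim/mpoly.mpolyind: f => [|c m f _ _ IH]; first by rewrite /perm_poly raddf0.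
rewrite /perm_poly raddfD /= -!/(perm_poly _ _) IH; congr (_ + _).
rewrite /perm_poly mpoly.mmapZ mpoly.mmapX -mpoly.mul_mpolyC; congr (_ * _).
rewrite -[RHS]mpoly.mmap1_id; apply: mpoly.mmap1_eq => k.
by rewrite !perm1 /sym_X var_pairK.
Qed.

(* Row and column i are moved to position s i. *)
Definition perm_sym_mx (K : Type) (s : 'S_n) (A : 'M[K]_n) : 'M[K]_n :=
  row_perm s^-1 (col_perm s^-1 A).

Lemma perm_sym_mxE (K : Type) (s : 'S_n) (A : 'M[K]_n) (i j : 'I_n) :
  perm_sym_mx s A (s i) (s j) = A i j.
Proof. by rewrite !mxE !permK. Qed.

Lemma perm_sym_mxM (K : Type) (s t : 'S_n) (A : 'M[K]_n) :
  perm_sym_mx (s * t)%g A = perm_sym_mx t (perm_sym_mx s A).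
Proof. by apply/matrixP => i j; rewrite !mxE invMg !permM. Qed.

Lemma perm_sym_mx1 (K : Type) (A : 'M[K]_n) : perm_sym_mx 1%g A = A.
Proof. by apply/matrixP => i j; rewrite !mxE invg1 !perm1. Qed.

End Coordinates.

Section GibbsVariety.
Variables (R : realType) (n : nat).
Local Notation C := R[i].

(* The ambient space is that of complex symmetric matrices. *)
Definition zero_locus (F : set (sym_poly n C)) : set 'M[C]_n :=
  [set M | M \is symmetricmx /\ forall f, F f -> sym_eval M f = 0].

Definition zariski_closed (V : set 'M[C]_n) : Prop :=
  exists F : set (sym_poly n C), V = zero_locus F.

Definition zariski_closure (S : set 'M[C]_n) : set 'M[C]_n :=
  smallest zariski_closed S.

Definition gibbs_variety (L : {vspace 'M[R]_n}) : set 'M[C]_n :=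
  zariski_closure
    [set map_mx (real_complex R) (expmx A) | A in [set A | A \in L]].

Definition vanishing_ideal (V : set 'M[C]_n) : set (sym_poly n R) :=
  [set f | forall M, V M ->
     sym_eval M (mpoly.map_mpoly (real_complex R) f) = 0].

End GibbsVariety.

Definition invariant_under (T : Type) (act : T -> T) (S : set T) : Prop :=
  act @` S `<=` S.

(* As permutations have finite order, stability is the same as equality. *)
Lemma invariant_underE (T : Type) (n : nat) (act : 'S_n -> T -> T)
    (act1 : forall x, act 1%g x = x)
    (actM : forall s t x, act (s * t)%g x = act t (act s x))
    (s : 'S_n) (S : set T) :
  invariant_under (act s) S <-> act s @` S = S.
Proof.
split=> [invS|eqS]; last by rewrite /invariant_under eqS.
apply/seteqP; split=> // x Sx.
have actX k y : S y -> S (act (s ^+ k)%g y).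
  elim: k y => [|k IH] y Sy; first by rewrite expg0 act1.
  by rewrite expgSr actM; apply: invS; exists (act (s ^+ k)%g y) => //; apply: IH.
exists (act (s ^+ #[s]%g.-1)%g x); first exact: actX.
by rewrite -actM -expgSr prednK ?order_gt0 // expg_order act1.
Qed.

Lemma invariant_perm_polyE (n : nat) (K : comNzRingType) (s : 'S_n)
    (S : set (sym_poly n K)) :
  invariant_under (perm_poly s) S <-> perm_poly s @` S = S.
Proof.
exact: (invariant_underE (@perm_poly1 n K) (@perm_polyM n K)).
Qed.

Lemma invariant_perm_sym_mxE (n : nat) (K : Type) (s : 'S_n)
    (S : set 'M[K]_n) :
  invariant_under (perm_sym_mx s) S <-> perm_sym_mx s @` S = S.
Proof.
exact: (invariant_underE (@perm_sym_mx1 n K) (@perm_sym_mxM n K)).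
Qed.

(* Main.v *)
Require Import Defs.
From mathcomp Require Import all_boot all_order all_algebra all_fingroup.
From mathcomp Require Import all_classical all_reals all_analysis.
From mathcomp Require Import complex.
From mathcomp Require mpoly.
Import (canonicals) mpoly.

Import Order.TTheory GRing.Theory Num.Theory.
Import numFieldNormedType.Exports.
Local Open Scope classical_set_scope.
Local Open Scope ring_scope.

(** Renaming the coordinates of a polynomial by [s] and evaluating the result
at a symmetric matrix [M] amounts to evaluating the original polynomial at the
matrix [M] permuted by [s^-1] ([sym_eval_perm]). The matrix exponential
commutes with simultaneous permutations of rows and columns ([expmx_perm]),
because these are conjugations by permutation matrices. Hence, if [f] vanishes
on the Gibbs variety and [A] is in [L], the value of [perm_poly s f] at
[exp A] is the value of [f] at [exp A'], where [A'] is [A] permuted by [s^-1].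
As permutations have finite order, invariance of [L] under [s] gives
invariance under [s^-1], so [A'] is in [L] and that value is zero. Thus
[perm_poly s f] vanishes on [exp L]; its zero locus is Zariski closed, so it
vanishes on the closure too.

The exponential is defined as the limit of a series of matrices. To move a
permutation or a transposition through that limit, the exponential is computed
entry by entry ([expmx_coordE]), which rests on the absolute convergence of
each entry of the series ([is_cvg_expmx_coord]). Transposition matters because
the Zariski closure is taken among symmetric matrices: the locus of
[perm_poly s f] contains [exp A] only if [exp A] is symmetric. *)

(** There are finitely many entries, so the neighbourhoods of [M] obtained from
each of them hold simultaneously along the filter. *)
Lemma cvg_mx_coord (T : topologicalType) (m n : nat) (X : Type)
    (F : set_system X) (FF : Filter F) (u : X -> 'M[T]_(m, n))
    (M : 'M[T]_(m, n)) :
  (forall i j, u x i j @[x --> F] --> M i j) -> u x @[x --> F] --> M.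
Proof.
move=> uM S [B MB sBS].
have uB : \forall x \near F, forall i j, B i j (u x i j).
  apply: filter_forall => i; apply: filter_forall => j.
  by apply: uM; apply: MB.
by apply: filterS uB => x uBx; apply: sBS.
Qed.

(** The sum [c] of all [`|A p q|] bounds every column sum of absolute values,
so multiplying by [A] enlarges the largest entry of a row by a factor of at
most [c]. *)
Lemma normr_exprmx_le (R : realDomainType) (n : nat) (A : 'M[R]_n) (k : nat)
    (i j : 'I_n) :
  `|(A ^+ k) i j| <= (\sum_(p < n) \sum_(q < n) `|A p q|) ^+ k.
Proof.
set c := \sum_(p < n) _.
have c0 : 0 <= c by apply: sumr_ge0 => p _; apply: sumr_ge0.
have col_le (l : 'I_n) : \sum_(p < n) `|A p l| <= c.
  apply: ler_sum => p _; rewrite (bigD1 l) //= lerDl.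
  by apply: sumr_ge0.
elim: k j => [|k IH] j.
  by rewrite !expr0 mxE; case: eqP; rewrite ?normr1 ?normr0 ?ler01.
rewrite !exprSr mxE; apply: le_trans (ler_norm_sum _ _ _) _.
apply: (@le_trans _ _ (\sum_(p < n) c ^+ k * `|A p j|)).
  by apply: ler_sum => p _; rewrite normrM ler_wpM2r.
by rewrite -mulr_sumr ler_wpM2l ?exprn_ge0.
Qed.

(** Comparison with the real exponential series at the sum of all
[`|A p q|]. *)
Lemma is_cvg_expmx_coord (R : realType) (n : nat) (A : 'M[R]_n) (i j : 'I_n) :
  cvgn (series (fun k => (k`!%:R)^-1 * (A ^+ k) i j)).
Proof.
apply: normed_cvg.
apply: (@series_le_cvg _ _
  (exp_coeff (\sum_(p < n) \sum_(q < n) `|A p q|))) => [k|k|k|].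
- exact: normr_ge0.
- by apply: exp_coeff_ge0; apply: sumr_ge0 => p _; apply: sumr_ge0.
- rewrite exp_coeffE /= normrM ger0_norm ?invr_ge0 ?ler0n //.
  by rewrite ler_wpM2l ?invr_ge0 ?ler0n ?normr_exprmx_le.
- exact: is_cvg_series_exp_coeff.
Qed.

(** Convergence of all the entries identifies the limit: reindexings of the
entries can then be carried out inside real series. *)
Lemma expmx_coordE (R : realType) (n : nat) (A : 'M[R]_n) (i j : 'I_n) :
  expmx A i j = limn (series (fun k => (k`!%:R)^-1 * (A ^+ k) i j)).
Proof.
pose E : 'M[R]_n :=
  \matrix_(p, q) limn (series (fun k => (k`!%:R)^-1 * (A ^+ k) p q)).
suff -> : expmx A = E by rewrite mxE.
apply: cvg_lim; first exact: norm_hausdorff.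
apply: cvg_mx_coord => p q; rewrite mxE.
have -> : (fun x => series (fun k => (k`!%:R)^-1 *: A ^+ k) x p q) =
    series (fun k => (k`!%:R)^-1 * (A ^+ k) p q).
  apply/funext => N; rewrite /series /= summxE.
  by apply: eq_bigr => k _; rewrite mxE.
exact: is_cvg_expmx_coord.
Qed.

Lemma trmx_exprn (R : comPzRingType) (n : nat) (A : 'M[R]_n) (k : nat) :
  (A ^+ k)^T = A^T ^+ k.
Proof.
elim: k => [|k IH]; first by rewrite !expr0 trmx1.
by rewrite exprS exprSr -IH; apply: trmx_mul.
Qed.

Lemma perm_sym_mx_exprn (R : pzRingType) (n : nat) (s : 'S_n) (A : 'M[R]_n)
    (k : nat) :
  perm_sym_mx s (A ^+ k) = perm_sym_mx s A ^+ k.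
Proof.
elim: k => [|k IH].
  by rewrite !expr0; apply/matrixP => i j; rewrite !mxE (inj_eq perm_inj).
rewrite !exprS -IH; apply/matrixP => i j; rewrite !mxE.
by rewrite (reindex_perm s^-1%g); apply: eq_bigr => l _; rewrite !mxE.
Qed.

Lemma expmx_tr (R : realType) (n : nat) (A : 'M[R]_n) :
  expmx A^T = (expmx A)^T.
Proof.
apply/matrixP => i j; rewrite mxE !expmx_coordE.
by under eq_fun do rewrite -trmx_exprn mxE.
Qed.

Lemma expmx_perm (R : realType) (n : nat) (s : 'S_n) (A : 'M[R]_n) :
  expmx (perm_sym_mx s A) = perm_sym_mx s (expmx A).
Proof.
apply/matrixP => i j; rewrite !mxE !expmx_coordE.
by under eq_fun do rewrite -perm_sym_mx_exprn !mxE.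
Qed.

Lemma symmetricmxP (K : fieldType) (n : nat) (M : 'M[K]_n) :
  reflect (M^T = M) (M \is symmetricmx).
Proof.
rewrite is_hermitianmxE expr0 scale1r map_mx_id // eq_sym.
exact: eqP.
Qed.

(** Both sides are algebra morphisms in [f] and agree on variables: [x_ij] is
sent to [M (s i) (s j)]. Symmetry of [M] is essential, since [s] need not
preserve the order of the pair [(i, j)] representing a variable. *)
Lemma sym_eval_perm (K : comNzRingType) (n : nat) (s : 'S_n) (M : 'M[K]_n)
    (f : sym_poly n K) :
  M^T = M ->
  sym_eval M (perm_poly s f) = sym_eval (perm_sym_mx s^-1 M) f.
Proof.
move=> symM.
elim/mpoly.mpolyind: f => [|c m f _ _ IH].
  by rewrite /sym_eval /perm_poly !raddf0.
rewrite /sym_eval /perm_poly !raddfD /= -/(perm_poly _ _) -!/(sym_eval _ _) IH.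
congr (_ + _).
rewrite /sym_eval /perm_poly mpoly.mmapZ rmorphM /= mpoly.mevalC mpoly.mevalZ.
congr (_ * _); rewrite mpoly.mmapX mpoly.mevalX /mpoly.mmap1 rmorph_prod /=.
apply: eq_bigr => k _; rewrite rmorphXn /= -/(sym_eval _ _) sym_eval_X //.
by rewrite !mxE invgK.
Qed.

Lemma map_perm_poly (K K' : comNzRingType) (h : {rmorphism K -> K'}) (n : nat)
    (s : 'S_n) (f : sym_poly n K) :
  mpoly.map_mpoly h (perm_poly s f) = perm_poly s (mpoly.map_mpoly h f).
Proof.
elim/mpoly.mpolyind: f => [|c m f _ _ IH].
  by rewrite /perm_poly !raddf0.
rewrite /perm_poly !raddfD /= -!/(perm_poly _ _) IH; congr (_ + _).
rewrite /perm_poly mpoly.mmapZ rmorphM /= mpoly.map_mpolyC mpoly.map_mpolyZ.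
rewrite mpoly.mmapZ; congr (_ * _).
rewrite mpoly.map_mpolyX !mpoly.mmapX /mpoly.mmap1 rmorph_prod /=.
by apply: eq_bigr => k _; rewrite rmorphXn /= mpoly.map_mpolyX.
Qed.

Theorem proposition2p3 (R : realType) (n : nat) (s : 'S_n)
    (L : {vspace 'M[R]_n})
    (symL : forall A : 'M[R]_n, A \in L -> A \is symmetricmx)
    (invL : invariant_under (perm_sym_mx s) [set A : 'M[R]_n | A \in L]) :
  invariant_under (perm_poly s) (vanishing_ideal (gibbs_variety L)).
Proof.
move=> _ [f If <-] M GVM.
pose g := mpoly.map_mpoly (real_complex R) (perm_poly s f).
(* A Zariski closed set containing [exp L] contains the Gibbs variety. *)
suff [_] : zero_locus [set g] M by apply.
apply: GVM; split; first by exists [set g].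
move=> _ [A LA <-].
have symE : map_mx (real_complex R) (expmx A) \is symmetricmx.
  have /symmetricmxP trA := symL A LA.
  by apply/symmetricmxP; rewrite map_trmx -expmx_tr trA.
split=> // _ ->; rewrite /g map_perm_poly sym_eval_perm; last exact/symmetricmxP.
have -> : perm_sym_mx s^-1 (map_mx (real_complex R) (expmx A)) =
    map_mx (real_complex R) (expmx (perm_sym_mx s^-1 A)).
  by rewrite expmx_perm; apply/matrixP => i j; rewrite !mxE.
apply: If; apply: sub_gen_smallest; exists (perm_sym_mx s^-1 A) => //=.
have /invariant_perm_sym_mxE eqL := invL.
have [B LB <-] : (perm_sym_mx s @` [set A : 'M[R]_n | A \in L]) A by rewrite eqL.
by rewrite -perm_sym_mxM mulgV perm_sym_mx1.
Qed.
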